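(* Let $k$ be a field, let $V$ be the underlying $k$-vector space of the localization $k[t]_{(t)}$ of the polynomial ring $k[t]$ at the prime ideal $(t)$ (i.e., the subalgebra of the rational function field $k(t)$ consisting of the elements having denominator not divisible by $t$), and let $R=\mathrm{End}_k(V)$ be the $k$-algebra of all $k$-linear endomorphisms of $V$, written on the left of their arguments and composed accordingly. Let $y\in R$ be given by $$y(f(t)) = t\,f(t)\quad\text{for } f(t)\in V,$$ and let $x\in R$ be given by $$x(f(t)) = t^{-1}\,(f(t)-f(0))\quad\text{for } f(t)\in V.$$ Then $x$ and $y$ are both strongly clean elements of $R$, and they satisfy $x\,y=1$ but $y\,x\neq 1$.
   Context: All rings are associative and unital. An element $x$ of a ring $R$ is called strongly clean if it can be written as $x=e+u$ with $e\in R$ idempotent, $u\in R$ a unit (two-sided invertible element), and $eu=ue$. For $f(t)\in k[t]_{(t)}$, $f(0)\in k$ denotes the value of the rational function $f$ at $t=0$, which is defined since the denominator of $f$ is not divisible by $t$. *)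

(* Defs.v *)
From HB Require Import structures.
From mathcomp Require Import all_boot all_algebra.
From mathcomp Require Import boolp.

Set Implicit Arguments.
Unset Strict Implicit.
Unset Printing Implicit Defensive.

Import GRing.Theory.
Local Open Scope ring_scope.

Definition idempotent_elt (R : pzRingType) (e : R) : Prop := e * e = e.

Definition two_sided_unit (R : pzRingType) (u : R) : Prop :=
  exists v : R, u * v = 1 /\ v * u = 1.

Definition strongly_clean (R : pzRingType) (x : R) : Prop :=
  exists e u : R,
    [/\ idempotent_elt e, two_sided_unit u, x = e + u & e * u = u * e].

(* End_k(V) for an arbitrary, possibly infinite-dimensional V; the library's
   'End(V) requires V to be a vectType. *)
Definition endo (k : pzRingType) (V : lmodType k) := {linear V -> V}.

Section EndoRing.
Variables (k : pzRingType) (V : lmodType k).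
Implicit Types f g h : endo V.

HB.instance Definition _ := gen_eqMixin (endo V).
HB.instance Definition _ := gen_choiceMixin (endo V).

Lemma endoP f g : (forall v, f v = g v) -> f = g.
Proof.
move=> fg.
case: f g fg => f [[a] [b]] [g [[c] [d]]] /= /funext fg.
move: a b c d; rewrite fg => a b c d.
by rewrite (Prop_irrelevance a c) (Prop_irrelevance b d).
Qed.

Definition endo0 : endo V := \0 : {linear V -> V}.
Definition endoN f : endo V := \- f : {linear V -> V}.
Definition endoD f g : endo V := f \+ g : {linear V -> V}.
Definition endo1 : endo V := idfun : {linear V -> V}.
Definition endoM f g : endo V := f \o g : {linear V -> V}.

Fact endoDA : associative endoD.
Proof. by move=> f g h; apply: endoP => v /=; rewrite addrA. Qed.
Fact endoDC : commutative endoD.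
Proof. by move=> f g; apply: endoP => v /=; rewrite addrC. Qed.
Fact endoD0 : left_id endo0 endoD.
Proof. by move=> f; apply: endoP => v /=; rewrite add0r. Qed.
Fact endoDN : left_inverse endo0 endoN endoD.
Proof. by move=> f; apply: endoP => v /=; rewrite addNr. Qed.

HB.instance Definition _ :=
  GRing.isZmodule.Build (endo V) endoDA endoDC endoD0 endoDN.

Fact endoMA : associative endoM.
Proof. by move=> f g h; apply: endoP. Qed.
Fact endo1M : left_id endo1 endoM.
Proof. by move=> f; apply: endoP. Qed.
Fact endoM1 : right_id endo1 endoM.
Proof. by move=> f; apply: endoP. Qed.
Fact endoMDl : left_distributive endoM +%R.
Proof. by move=> f g h; apply: endoP. Qed.
Fact endoMDr : right_distributive endoM +%R.
Proof. by move=> f g h; apply: endoP => v /=; rewrite linearD. Qed.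

HB.instance Definition _ :=
  GRing.Zmodule_isPzRing.Build (endo V) endoMA endo1M endoM1 endoMDl endoMDr.

Lemma endo_addE f g v : (f + g) v = f v + g v. Proof. by []. Qed.
Lemma endo_oppE f v : (- f) v = - f v. Proof. by []. Qed.
Lemma endo_zeroE v : (0 : endo V) v = 0. Proof. by []. Qed.
Lemma endo_mulE f g v : (f * g) v = f (g v). Proof. by []. Qed.
Lemma endo_oneE v : (1 : endo V) v = v. Proof. by []. Qed.

End EndoRing.

Section EndoAlgebra.
Variables (k : comPzRingType) (V : lmodType k).
Implicit Types f g : endo V.

Definition endoZ (a : k) f : endo V := a \*: f : {linear V -> V}.

Fact endoZA a b f : endoZ a (endoZ b f) = endoZ (a * b) f.
Proof. by apply: endoP => v /=; rewrite scalerA. Qed.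
Fact endo1Z : left_id 1 endoZ.
Proof. by move=> f; apply: endoP => v /=; rewrite scale1r. Qed.
Fact endoZDr : right_distributive endoZ +%R.
Proof. by move=> a f g; apply: endoP => v /=; rewrite scalerDr. Qed.
Fact endoZDl f : {morph endoZ^~ f : a b / a + b}.
Proof. by move=> a b; apply: endoP => v /=; rewrite scalerDl. Qed.

HB.instance Definition _ :=
  GRing.Zmodule_isLmodule.Build k (endo V) endoZA endo1Z endoZDr endoZDl.

Fact endoZAl (a : k) f g : a *: (f * g) = a *: f * g.
Proof. by apply: endoP. Qed.
Fact endoZAr (a : k) f g : a *: (f * g) = f * (a *: g).
Proof. by apply: endoP => v /=; rewrite linearZ. Qed.

End EndoAlgebra.

Notation "x %:F" := (@FracField.tofrac _ x) : ring_scope.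

Fact scale_frac_addE (K : fieldType) (a p q r s : K) : q != 0 -> s != 0 ->
  a * (p / q) + r / s = (a * p * s + r * q) / (q * s).
Proof. by move=> q0 s0; rewrite mulrA addf_div. Qed.

Fact shift_formula_linear (k : nzRingType) (A : algType k) (c u v : A)
    (a b e : k) :
  c * ((a *: u + v) - (a * b + e)%:A) =
  a *: (c * (u - b%:A)) + c * (v - e%:A).
Proof.
by rewrite scalerDl -scalerA scalerAr -mulrDr scalerBr opprD addrACA.
Qed.

Section RationalFunctions.
Variable k : fieldType.
Local Notation K := {fraction {poly k}}.

Definition ratfun_scale (a : k) (f : K) : K := a%:P%:F * f.

Fact ratfun_scaleA a b f :
  ratfun_scale a (ratfun_scale b f) = ratfun_scale (a * b) f.
Proof. by rewrite /ratfun_scale mulrA -tofracM -polyCM. Qed.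
Fact ratfun_scale1 : left_id 1 ratfun_scale.
Proof. by move=> f; rewrite /ratfun_scale tofrac1 mul1r. Qed.
Fact ratfun_scaleDr : right_distributive ratfun_scale +%R.
Proof. by move=> a f g; rewrite /ratfun_scale mulrDr. Qed.
Fact ratfun_scaleDl f : {morph ratfun_scale^~ f : a b / a + b}.
Proof. by move=> a b; rewrite /ratfun_scale polyCD tofracD mulrDl. Qed.

HB.instance Definition _ := GRing.Zmodule_isLmodule.Build k K
  ratfun_scaleA ratfun_scale1 ratfun_scaleDr ratfun_scaleDl.

Fact ratfun_scaleAl (a : k) (f g : K) : a *: (f * g) = a *: f * g.
Proof. exact: mulrA. Qed.

HB.instance Definition _ := GRing.Lmodule_isLalgebra.Build k K ratfun_scaleAl.

Fact ratfun_scaleAr (a : k) (f g : K) : a *: (f * g) = f * (a *: g).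
Proof. exact: mulrCA. Qed.

HB.instance Definition _ := GRing.Lalgebra_isAlgebra.Build k K ratfun_scaleAr.

Lemma ratfun_scaleE (a : k) (f : K) : a *: f = a%:P%:F * f.
Proof. by []. Qed.

(* k[t]_(t) inside k(t), with t encoded as 'X; the representing fraction p / q
   need not be in lowest terms. *)
Definition regular0 : {pred K} := fun f =>
  `[< exists p q : {poly k}, ~~ ('X %| q) /\ f = p%:F / q%:F >].

Lemma regular0P (f : K) :
  reflect (exists p q : {poly k}, ~~ ('X %| q) /\ f = p%:F / q%:F)
          (f \in regular0).
Proof. exact: asboolP. Qed.

Lemma dvdX_horner0 (q : {poly k}) : ('X %| q) = (q.[0] == 0).
Proof. by rewrite -['X]subr0 -polyC0 dvdp_XsubCl. Qed.

Lemma ndvdX_tofrac_neq0 (q : {poly k}) : ~~ ('X %| q) -> q%:F != 0.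
Proof. by apply: contraNneq => /eqP; rewrite tofrac_eq0 => /eqP->. Qed.

Fact frac_linear_comb (a : k) (p q r s : {poly k}) :
  ~~ ('X %| q) -> ~~ ('X %| s) ->
  a *: (p%:F / q%:F) + r%:F / s%:F = (a%:P * p * s + r * q)%:F / (q * s)%:F.
Proof.
move=> /ndvdX_tofrac_neq0 q0 /ndvdX_tofrac_neq0 s0.
rewrite tofracD (tofracM r q) (tofracM _ s) (tofracM _ p) (tofracM q s).
by rewrite ratfun_scaleE; exact: (scale_frac_addE _ _ _ q0 s0).
Qed.

Fact frac_mul (p q r s : {poly k}) :
  (p%:F / q%:F) * (r%:F / s%:F) = (p * r)%:F / (q * s)%:F.
Proof. by rewrite (tofracM p r) (tofracM q s); apply: mulf_div. Qed.

Fact ndvdX_mul (q s : {poly k}) :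
  ~~ ('X %| q) -> ~~ ('X %| s) -> ~~ ('X %| q * s).
Proof. by rewrite !dvdX_horner0 hornerM mulf_eq0 negb_or => -> ->. Qed.

Fact regular0_subalg : subalg_closed regular0.
Proof.
split=> [|a f g|f g].
- apply/regular0P; exists 1, 1.
  by rewrite dvdX_horner0 hornerC oner_eq0 tofrac1 divr1.
- move=> /regular0P[p [q [q0 ->]]] /regular0P[r [s [s0 ->]]].
  apply/regular0P; exists (a%:P * p * s + r * q), (q * s).
  by split; [exact: ndvdX_mul | exact: frac_linear_comb].
- move=> /regular0P[p [q [q0 ->]]] /regular0P[r [s [s0 ->]]].
  apply/regular0P; exists (p * r), (q * s).
  by split; [exact: ndvdX_mul | exact: frac_mul].
Qed.

HB.instance Definition _ :=
  GRing.isSubalgClosed.Build k K regular0 regular0_subalg.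

Record loc0 := Loc0 { loc0_val :> K; loc0_valP : loc0_val \in regular0 }.

HB.instance Definition _ := [isSub for loc0_val].
HB.instance Definition _ := [Choice of loc0 by <:].
HB.instance Definition _ := [SubChoice_isSubComNzRing of loc0 by <:].
HB.instance Definition _ := [SubZmodule_isSubLmodule of loc0 by <:].
HB.instance Definition _ := [SubNzRing_SubLmodule_isSubLalgebra of loc0 by <:].
HB.instance Definition _ := [SubLalgebra_isSubAlgebra of loc0 by <:].

Fact loc0_fracP (f : loc0) : exists pq : {poly k} * {poly k},
  ~~ ('X %| pq.2) && (val f == pq.1%:F / pq.2%:F).
Proof.
by have /regular0P[p [q [q0 fE]]] := valP f; exists (p, q); rewrite q0 fE /=.
Qed.

(* The value f(0), computed on a chosen fraction p / q representing f with t
   not dividing q; by eval0E it does not depend on this choice. *)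
Definition eval0 (f : loc0) : k :=
  let pq := xchoose (loc0_fracP f) in pq.1.[0] / pq.2.[0].

Lemma eval0E (f : loc0) (p q : {poly k}) :
  ~~ ('X %| q) -> val f = p%:F / q%:F -> eval0 f = p.[0] / q.[0].
Proof.
move=> q0 fE; rewrite /eval0.
case: xchoose (xchooseP (loc0_fracP f)) => r s /= /andP[s0 /eqP].
rewrite fE => /eqP; rewrite eqr_div ?ndvdX_tofrac_neq0 //.
rewrite -!tofracM tofrac_eq => /eqP/(congr1 (fun h => h.[0])).
rewrite !hornerM => E; move: q0 s0; rewrite !dvdX_horner0 => q0 s0.
by apply/eqP; rewrite eqr_div // E.
Qed.

Fact X_regular0 : ('X : {poly k})%:F \in regular0.
Proof.
apply/regular0P; exists 'X, 1.
by rewrite dvdX_horner0 hornerC oner_eq0 tofrac1 divr1.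
Qed.

Definition t0 : loc0 := Loc0 X_regular0.

Definition mulX_fun (f : loc0) : loc0 := t0 * f.

Fact mulX_is_linear : linear mulX_fun.
Proof. by move=> a f g; rewrite /mulX_fun mulrDr scalerAr. Qed.

HB.instance Definition _ :=
  GRing.isLinear.Build k loc0 loc0 *:%R mulX_fun mulX_is_linear.

Definition mulX : endo loc0 := mulX_fun : {linear loc0 -> loc0}.

Definition shiftX_val (f : loc0) : K :=
  ('X : {poly k})%:F^-1 * (val f - (eval0 f)%:A).

Fact shiftX_val_regular (f : loc0) : shiftX_val f \in regular0.
Proof.
have /regular0P[p [q [q0 fE]]] := valP f.
have qF := ndvdX_tofrac_neq0 q0.
have XF : ('X : {poly k})%:F != 0 by rewrite tofrac_eq0 polyX_eq0.
have /dvdpP[r rE] : 'X %| p - (eval0 f)%:P * q.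
  rewrite dvdX_horner0 !hornerE (eval0E q0 fE) divfK ?subrr //.
  by rewrite -dvdX_horner0.
apply/regular0P; exists r, q; split=> //.
have numE : val f - (eval0 f)%:A = r%:F * 'X%:F / q%:F.
  rewrite -(tofracM r 'X) -rE tofracB (tofracM _ q) mulrBl (mulfK qF).
  by rewrite fE ratfun_scaleE mulr1.
by rewrite /shiftX_val numE [r%:F * _]mulrC -mulrA (mulKf XF).
Qed.

Definition shiftX_fun (f : loc0) : loc0 := Loc0 (shiftX_val_regular f).

Fact eval0_is_linear (a : k) (f g : loc0) :
  eval0 (a *: f + g) = a * eval0 f + eval0 g.
Proof.
have /regular0P[p [q [q0 fE]]] := valP f.
have /regular0P[r [s [s0 gE]]] := valP g.
have qs := ndvdX_mul q0 s0.
rewrite (@eval0E _ (a%:P * p * s + r * q) _ qs) ?(eval0E q0 fE) ?(eval0E s0 gE).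
  move: q0 s0; rewrite !dvdX_horner0 => q0 s0.
  by rewrite !(hornerD, hornerM, hornerC) scale_frac_addE.
have -> : val (a *: f + g) = a *: val f + val g by [].
by rewrite fE gE; apply: frac_linear_comb.
Qed.

Fact shiftX_is_linear : linear shiftX_fun.
Proof.
move=> a f g; apply: val_inj.
have valE : forall b u v, val (b *: u + v : loc0) = b *: val u + val v by [].
rewrite valE /= /shiftX_val valE eval0_is_linear.
exact: shift_formula_linear.
Qed.

HB.instance Definition _ :=
  GRing.isLinear.Build k loc0 loc0 *:%R shiftX_fun shiftX_is_linear.

Definition shiftX : endo loc0 := shiftX_fun : {linear loc0 -> loc0}.

Lemma mulXE (f : loc0) : val (mulX f) = 'X%:F * val f.
Proof. by []. Qed.

Lemma shiftXE (f : loc0) :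
  val (shiftX f) = 'X%:F^-1 * (val f - (eval0 f)%:A).
Proof. by []. Qed.

End RationalFunctions.

(* Main.v *)
Require Import Defs.
From HB Require Import structures.
From mathcomp Require Import all_boot all_algebra.
Import GRing.Theory.

Set Implicit Arguments.
Unset Strict Implicit.
Unset Printing Implicit Defensive.

Local Open Scope ring_scope.

(** Multiplication by [1 - t] is invertible on [V], because [1 - t] does not
    vanish at [0]; hence [y = 1 + (y - 1)] is strongly clean with idempotent
    [1].

    For [x], split [V] as the direct sum of [k[t]] and the space of proper
    fractions [m / q], [deg m < deg q], and let [e] be the projection onto
    [k[t]] (it sends [p / q] to the Euclidean quotient of [p] by [q]).  Both
    summands are stable under [x], that is, [e] commutes with [x]
    ([polyproj_shiftX]).  On [k[t]] the shift [x] is locally nilpotent, so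
    [x - 1] is bijective there.  On the proper fractions [x] is bijective:
    its kernel on [V] is the constants, none of which but [0] is proper, and
    a preimage of [g] is the proper part of [t g].  Thus [x - e] is invertible
    on each summand.

    This argument needs very little about [V], and its formal part takes place
    in an arbitrary ring ([strongly_clean_left_inverse]).  Assume [x y = 1] and
    that [w] is the inverse of [1 - y].  Then [w y] is a right inverse of
    [x - 1 = x (1 - y)], and [1 - w y (x - 1) = w (1 - y x)].  So the corners
    [e w y e] and [(1 - e) y (1 - e)] are right inverses of [x - 1] and [x] on
    the two summands, and they are left inverses once [e] fixes the range of
    [1 - y x] (the constants, here) and kills its image under [w] (the
    multiples of [1 / (1 - t)], here). *)

(** * Strong cleanness in an arbitrary ring *)

(** The idempotent is [1], so that no commutation is at stake. *)
Lemma strongly_clean_unitB1 (R : pzRingType) (x : R) :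
  two_sided_unit (x - 1) -> strongly_clean x.
Proof.
move=> xU; exists 1, (x - 1).
by split; rewrite /idempotent_elt ?mulr1 ?mul1r // addrC subrK.
Qed.

(** Peirce decomposition: block-diagonal elements multiply blockwise. *)
Lemma peirce_mul (R : pzRingType) (e g a b a' b' : R) :
  idempotent_elt e -> idempotent_elt g -> e * g = 0 -> g * e = 0 ->
  (e * a * e + g * b * g) * (e * a' * e + g * b' * g)
  = e * a * e * a' * e + g * b * g * b' * g.
Proof.
move=> ee gg eg ge; rewrite mulrDl !mulrDr !mulrA.
rewrite -(mulrA _ e g) -(mulrA _ g e) -(mulrA _ e e) -(mulrA _ g g) ee gg eg ge.
by rewrite !mulr0 !mul0r addr0 add0r.
Qed.

(** The idempotent [e] separates a part on which [x - 1] is invertible from a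
    part on which [x] is.  The last two hypotheses say that the defects
    [1 - y x] and [1 - w y (x - 1) = w (1 - y x)] of the right inverses [y] of
    [x] and [w y] of [x - 1] lie each in the part where it does no harm. *)
Lemma strongly_clean_left_inverse (R : pzRingType) (x y w e : R) :
  x * y = 1 -> (1 - y) * w = 1 -> w * (1 - y) = 1 ->
  idempotent_elt e -> e * x = x * e ->
  e * (1 - y * x) = 1 - y * x -> e * w * (1 - y * x) = 0 ->
  strongly_clean x.
Proof.
move=> xy yw wy ee ex e_def e_wdef.
exists e, (x - e); split=> //; [| by rewrite addrC subrK
                               | by rewrite mulrBr mulrBl ex].
pose g := 1 - e.
have ge : g * e = 0 by rewrite mulrBl mul1r ee subrr.
have eg : e * g = 0 by rewrite mulrBr mulr1 ee subrr.
have gg : g * g = g by rewrite {1}/g mulrBl mul1r eg subr0.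
have ege : e + g = 1 by rewrite addrC subrK.
have gx : g * x = x * g by rewrite mulrBl mulrBr mul1r mulr1 ex.
have ex1 : e * (x - 1) = (x - 1) * e by rewrite mulrBr mulrBl mulr1 mul1r ex.
have -> : x - e = e * (x - 1) * e + g * x * g.
  by rewrite ex1 gx -!mulrA ee gg mulrBl mul1r addrAC -mulrDr ege mulr1.
exists (e * (w * y) * e + g * y * g).
split; rewrite peirce_mul //.
- have x1wy : (x - 1) * (w * y) = 1.
    have -> : x - 1 = x * (1 - y) by rewrite mulrBr mulr1 xy.
    by rewrite mulrA -(mulrA x) yw mulr1.
  have -> : e * (x - 1) * e = e * (x - 1) by rewrite ex1 -mulrA ee.
  have -> : g * x * g = g * x by rewrite gx -mulrA gg.
  by rewrite -(mulrA e) x1wy mulr1 ee -(mulrA g) xy mulr1 gg.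
- have wyx1 : w * y * (x - 1) = 1 - w * (1 - y * x).
    rewrite -[X in _ = X - _]wy -mulrBr -[LHS]mulrA; congr (w * _).
    by rewrite mulrBr mulr1 opprB [RHS]addrC addrA subrK.
  have gyx : g * y * x = g.
    apply/eqP; rewrite -subr_eq0 -opprB oppr_eq0 -mulrA -[X in X - _]mulr1.
    by rewrite -mulrBr mulrBl e_def mul1r subrr.
  have -> : e * (w * y) * e * (x - 1) * e = e * (w * y * (x - 1)) * e.
    by rewrite -(mulrA _ e) ex1 !mulrA -(mulrA _ e e) ee.
  have -> : g * y * g * x * g = g * y * x * g.
    by rewrite -(mulrA _ g) gx !mulrA -(mulrA _ g g) gg.
  by rewrite wyx1 mulrBr mulr1 (mulrA e w) e_wdef subr0 ee gyx gg.
Qed.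

(** * The polynomial part of a fraction *)

Section RationalFunctions.
Variable k : fieldType.
Implicit Types (f g : loc0 k) (p q : {poly k}).

(** The quotient is computed on the chosen fraction that also serves for
    [eval0]; [polypartE] shows that any other fraction gives the same. *)
Definition polypart f : {poly k} :=
  let pq := xchoose (loc0_fracP f) in pq.1 %/ pq.2.

Lemma ndvdX_neq0 q : ~~ ('X %| q) -> q != 0.
Proof. by apply: contraNneq => ->; apply: dvdp0. Qed.

Lemma polypartE f p q :
  ~~ ('X %| q) -> val f = p%:F / q%:F -> polypart f = p %/ q.
Proof.
move=> q0 fE; rewrite /polypart.
case: xchoose (xchooseP (loc0_fracP f)) => r s /= /andP[s0 /eqP].
rewrite fE => /eqP; rewrite eqr_div ?ndvdX_tofrac_neq0 //.
rewrite -!tofracM tofrac_eq => /eqP E.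
have [qn0 sn0] := (ndvdX_neq0 q0, ndvdX_neq0 s0).
by rewrite -(divp_pmul2r r qn0 sn0) -E [s * q]mulrC divp_pmul2r.
Qed.

Lemma polypart_is_linear (a : k) f g :
  polypart (a *: f + g) = a *: polypart f + polypart g.
Proof.
have /regular0P[p [q [q0 fE]]] := valP f.
have /regular0P[r [s [s0 gE]]] := valP g.
rewrite (polypartE q0 fE) (polypartE s0 gE).
rewrite (@polypartE _ (a%:P * p * s + r * q) _ (ndvdX_mul q0 s0)).
  have [qn0 sn0] := (ndvdX_neq0 q0, ndvdX_neq0 s0).
  rewrite divpD (divp_pmul2r _ sn0 qn0).
  rewrite [q * s]mulrC (divp_pmul2r _ qn0 sn0).
  by rewrite mul_polyC divpZl.
have -> : val (a *: f + g) = a *: val f + val g by [].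
by rewrite fE gE; apply: frac_linear_comb.
Qed.

Lemma poly_regular0 p : p%:F \in @regular0 k.
Proof.
apply/regular0P; exists p, 1.
by rewrite dvdX_horner0 hornerC oner_eq0 tofrac1 divr1.
Qed.

Definition poly_loc0 p : loc0 k := Loc0 (poly_regular0 p).

Lemma val_poly_loc0 p : val (poly_loc0 p) = p%:F / 1%:F.
Proof. by rewrite tofrac1 divr1. Qed.

Lemma ndvdX1 : ~~ ('X %| (1 : {poly k})).
Proof. by rewrite dvdX_horner0 hornerC oner_eq0. Qed.

Lemma poly_locK p : polypart (poly_loc0 p) = p.
Proof. by rewrite (polypartE ndvdX1 (val_poly_loc0 p)) divp1. Qed.

Lemma eval0_poly_loc0 p : eval0 (poly_loc0 p) = p.[0].
Proof. by rewrite (eval0E ndvdX1 (val_poly_loc0 p)) hornerC divr1. Qed.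

Definition polyproj_fun f : loc0 k := poly_loc0 (polypart f).

Lemma polyproj_is_linear : linear polyproj_fun.
Proof.
move=> a f g; apply: val_inj => /=.
rewrite /polyproj_fun polypart_is_linear /= tofracD -mul_polyC.
by rewrite (tofracM a%:P).
Qed.

HB.instance Definition _ :=
  GRing.isLinear.Build k (loc0 k) (loc0 k) *:%R polyproj_fun polyproj_is_linear.

Definition polyproj : endo (loc0 k) := polyproj_fun : {linear loc0 k -> loc0 k}.

Lemma polyproj_poly p : polyproj (poly_loc0 p) = poly_loc0 p.
Proof. by rewrite /polyproj /= /polyproj_fun poly_locK. Qed.

Lemma polyproj_idem : idempotent_elt polyproj.
Proof. by apply: endoP => f; rewrite endo_mulE polyproj_poly. Qed.

Lemma shiftX_frac f p q r :
  ~~ ('X %| q) -> val f = p%:F / q%:F -> p - (eval0 f)%:P * q = r * 'X ->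
  val (shiftX k f) = r%:F / q%:F.
Proof.
move=> q0 fE rE.
have qF := ndvdX_tofrac_neq0 q0.
have XF : ('X : {poly k})%:F != 0 by rewrite tofrac_eq0 polyX_eq0.
apply: (mulfI XF); rewrite shiftXE mulVKf // mulrA -(tofracM 'X) mulrC.
rewrite ['X * r]mulrC -rE tofracB (tofracM _ q) mulrC mulrBl (mulfK qF).
by rewrite fE ratfun_scaleE mulr1.
Qed.

Lemma divp_polyX p : p %/ 'X * 'X = p - p.[0]%:P.
Proof.
have modX : p %% 'X = p.[0]%:P by rewrite -modp_XsubC subr0.
by rewrite [in RHS](divp_eq p 'X) hornerD hornerM hornerX modX mulr0 add0r
  hornerC addrK.
Qed.

(** Polynomials and proper fractions are both stable under [shiftX]: if
    [f = p / q] with [p = d q + m], [deg m < deg q], and if [p - f(0) q = r t],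
    so that [shiftX] maps [f] to [r / q], then Euclidean division of [r] by [q]
    gives [d %/ t], since the constant [f(0)] does not affect the quotient by
    [t]; and [d %/ t] is also the image of [d] under [shiftX]. *)
Lemma polyproj_shiftX : polyproj * shiftX k = shiftX k * polyproj.
Proof.
have X0 : ('X : {poly k}) != 0 by rewrite polyX_eq0.
apply: endoP => f; rewrite !endo_mulE; apply: val_inj.
have /regular0P[p [q [q0 fE]]] := valP f.
have /dvdpP[r rE] : 'X %| p - (eval0 f)%:P * q.
  rewrite dvdX_horner0 !hornerE (eval0E q0 fE) divfK ?subrr //.
  by rewrite -dvdX_horner0.
have -> : shiftX k (polyproj f) = poly_loc0 (p %/ q %/ 'X).
  apply: val_inj; rewrite -(polypartE q0 fE) [RHS]val_poly_loc0.
  apply: shiftX_frac; rewrite ?ndvdX1 ?val_poly_loc0 //.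
  by rewrite mulr1 eval0_poly_loc0 divp_polyX.
have qn0 := ndvdX_neq0 q0.
have rq : (r * 'X) %/ q = p %/ q - (eval0 f)%:P.
  by rewrite -rE divpD -mulNr (mulpK _ qn0).
have c0 : (- (eval0 f)%:P) %/ 'X = 0.
  by apply: divp_small; rewrite size_polyX ltnS -polyCN size_polyC_leq1.
have rqX : r %/ q = p %/ q %/ 'X.
  by rewrite -[r in LHS](mulpK r X0) (divpAC 'X q) rq divpD c0 addr0.
by congr (_%:F); rewrite (polypartE q0 (shiftX_frac q0 fE rE)).
Qed.

(** * The products of the shift and multiplication by t *)

Lemma subr1_mulX_shiftXE f : (1 - mulX k * shiftX k) f = poly_loc0 (eval0 f)%:P.
Proof.
apply: val_inj.
have XF : ('X : {poly k})%:F != 0 by rewrite tofrac_eq0 polyX_eq0.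
have -> : val ((1 - mulX k * shiftX k) f) = val f - val (mulX k (shiftX k f)).
  by [].
by rewrite mulXE shiftXE mulVKf // subKr ratfun_scaleE mulr1.
Qed.

Lemma shiftX_mulX : shiftX k * mulX k = 1.
Proof.
apply: endoP => f; rewrite endo_mulE endo_oneE; apply: val_inj.
have XF : ('X : {poly k})%:F != 0 by rewrite tofrac_eq0 polyX_eq0.
have /regular0P[p [q [q0 fE]]] := valP f.
have e0 : eval0 (mulX k f) = 0.
  rewrite (eval0E (p := 'X * p) q0); first by rewrite hornerM hornerX !mul0r.
  by rewrite mulXE fE (tofracM 'X) mulrA.
by rewrite shiftXE e0 scale0r subr0 mulXE mulKf.
Qed.

Lemma mulX_shiftX_neq1 : mulX k * shiftX k <> 1.
Proof.
(* The left-hand side kills the constant 1. *)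
move=> yx; have := subr1_mulX_shiftXE 1; rewrite yx subrr endo_zeroE.
rewrite (eval0E (p := 1) (q := 1) ndvdX1) ?tofrac1 ?divr1 //.
rewrite hornerC divr1 => /(congr1 val)/eqP.
by rewrite val_poly_loc0 polyC1 !tofrac1 divr1 eq_sym oner_eq0.
Qed.

(** * Multiplication by the inverse of 1 - t *)

Lemma ndvdX_subr1X : ~~ ('X %| (1 - 'X : {poly k})).
Proof. by rewrite dvdX_horner0 !hornerE subr0 oner_eq0. Qed.

Lemma subr1X_regular0 : (1 - 'X : {poly k})%:F^-1 \in @regular0 k.
Proof.
apply/regular0P; exists 1, (1 - 'X); split; first exact: ndvdX_subr1X.
by rewrite tofrac1 mul1r.
Qed.

Definition mul_geom_fun f : loc0 k := Loc0 subr1X_regular0 * f.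

Lemma mul_geom_is_linear : linear mul_geom_fun.
Proof. by move=> a f g; rewrite /mul_geom_fun mulrDr scalerAr. Qed.

HB.instance Definition _ :=
  GRing.isLinear.Build k (loc0 k) (loc0 k) *:%R mul_geom_fun mul_geom_is_linear.

Definition mul_geom : endo (loc0 k) := mul_geom_fun : {linear loc0 k -> loc0 k}.

Lemma mul_geomE f : val (mul_geom f) = (1 - 'X)%:F^-1 * val f.
Proof. by []. Qed.

Lemma subr1_mulXE f : val ((1 - mulX k) f) = (1 - 'X)%:F * val f.
Proof. by rewrite tofracB tofrac1 mulrBl mul1r. Qed.

Lemma mul_geomK : (1 - mulX k) * mul_geom = 1.
Proof.
apply: endoP => f; rewrite endo_mulE endo_oneE; apply: val_inj.
by rewrite subr1_mulXE mul_geomE (mulVKf (ndvdX_tofrac_neq0 ndvdX_subr1X)).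
Qed.

Lemma mul_geomVK : mul_geom * (1 - mulX k) = 1.
Proof.
apply: endoP => f; rewrite endo_mulE endo_oneE; apply: val_inj.
by rewrite mul_geomE subr1_mulXE (mulKf (ndvdX_tofrac_neq0 ndvdX_subr1X)).
Qed.

(** The numerator of [c / (1 - t)] has smaller degree than the denominator. *)
Lemma polyproj_mul_geom_const (c : k) :
  polyproj (mul_geom (poly_loc0 c%:P)) = 0.
Proof.
have cE : val (mul_geom (poly_loc0 c%:P)) = c%:P%:F / (1 - 'X)%:F.
  by rewrite mul_geomE mulrC.
apply: val_inj; rewrite [LHS]/((polypart _)%:F) (polypartE ndvdX_subr1X cE).
have szX : size (1 - 'X : {poly k}) = 2%N.
  by rewrite -size_polyN opprB -polyC1 size_XsubC.
by rewrite divp_small ?tofrac0 // szX ltnS size_polyC_leq1.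
Qed.

End RationalFunctions.

Theorem proposition1p3 (k : fieldType) :
  let x := shiftX k in
  let y := mulX k in
  [/\ strongly_clean x, strongly_clean y, x * y = 1 & y * x <> 1].
Proof.
move=> x y; split; [ | | exact: shiftX_mulX | exact: mulX_shiftX_neq1].
- apply: (@strongly_clean_left_inverse _ x y (mul_geom k) (polyproj k)).
  + exact: shiftX_mulX.
  + exact: mul_geomK.
  + exact: mul_geomVK.
  + exact: polyproj_idem.
  + exact: polyproj_shiftX.
  + apply: endoP => f.
    by rewrite endo_mulE subr1_mulX_shiftXE polyproj_poly.
  + apply: endoP => f; rewrite !endo_mulE subr1_mulX_shiftXE.
    exact: polyproj_mul_geom_const.
- apply: strongly_clean_unitB1; exists (- mul_geom k).
  have -> : y - 1 = - (1 - y) by rewrite opprB.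
  by rewrite !mulrNN mul_geomK mul_geomVK.
Qed.
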